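(* Let $\lambda=\zeta(3/2)/(2\zeta(3))$ and let $x>y>8$ be real. Define $b=b(x,y)$ by \[ y^{-b}=2-2\Bigl(1+\sqrt{2/y}\Bigr)^{-2\log x/\log(y/2)}. \] If $0<b<\tfrac12$, then \[ M(x,y):=\#\{n\le x:\ n\text{ a pnd},\ P(n)>y\}\ \le\ (\lambda+1)xy^{-b/3}+2xy^{-4b/9}. \]
   Context: $\sigma(n)$ is the sum of divisors of $n$. A positive integer $n$ is nondeficient if $\sigma(n)/n\ge2$ and deficient if $\sigma(n)/n<2$; $n$ is a primitive nondeficient number (pnd) if it is nondeficient and all its proper divisors are deficient. $P(n)$ denotes the largest prime factor of $n$ (with $P(1)=1$). *)

(* Defs.v *)
From HB Require Import structures.
From mathcomp Require Import all_boot all_order all_algebra.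
From mathcomp Require Import all_classical all_reals all_analysis.

Set Implicit Arguments.
Unset Strict Implicit.
Unset Printing Implicit Defensive.

Import Order.TTheory GRing.Theory Num.Theory.
Import numFieldNormedType.Exports.

Local Open Scope ring_scope.

Definition sigma (n : nat) : nat := (\sum_(d <- divisors n) d)%N.

Definition abundancy (n : nat) : rat := (sigma n)%:R / n%:R.

Definition nondeficient (n : nat) : bool := (0 < n)%N && (2 <= abundancy n).

Definition deficient (n : nat) : bool := (0 < n)%N && (abundancy n < 2).

Definition pnd (n : nat) : bool :=
  nondeficient n && all deficient [seq d <- divisors n | (d < n)%N].

(* Since [pnd 0 = false], starting the range at 1 loses nothing; for [0 <= x],
   [n < (Num.truncn x).+1] is [n%:R <= x].  [max_pdiv 1 = 1]. *)
Definition M (R : realType) (x y : R) : nat :=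
  (\sum_(1 <= n < (Num.truncn x).+1 | pnd n && (y < (max_pdiv n)%:R)%R) 1)%N.

(* The Dirichlet series; it is the Riemann zeta function only for [1 < s]. *)
Definition zeta (R : realType) (s : R) : R :=
  limn (series (fun k : nat => k.+1%:R `^ (- s))).

Definition lambda (R : realType) : R := zeta (3 / 2) / (2 * zeta 3).

(* Main.v *)
Require Import Defs.
From HB Require Import structures.
From mathcomp Require Import all_boot all_order all_algebra.
From mathcomp Require Import all_classical all_reals all_analysis.
From mathcomp Require Import zify ring lra.

Set Implicit Arguments.
Unset Strict Implicit.
Unset Printing Implicit Defensive.

Import Order.TTheory GRing.Theory Num.Theory.
Import numFieldNormedType.Exports.

(* Put v = y^(b/9) and Y = sqrt (y/2), so that v^6 <= Y.  Let n <= x be a pnd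
   with P(n) > y and let D be its Y-smooth part.  The prime factors of n/D,
   at most log x / log Y of them with multiplicity, each contribute at most
   1 + 1/Y to sigma(n)/n, so sigma(D)/D >= 2 - y^(-b); since D is deficient,
   2 - sigma(D)/D >= 1/D and hence D >= y^b = v^9.
   If the squarefull part of D is at most v^6, its squarefree part is at least
   v^3 and has a divisor d with v^3 <= d <= Y.  Then n |-> n/d is injective:
   for n = m d and n' = m d', the quotient of sigma(n)/n and sigma(n')/n' is
   within 1/P(n) of 1, while 2 d d' <= y, so sigma(d)/d = sigma(d')/d', and
   this forces d = d' for squarefree numbers.  So there are at most x/v^3 such n.
   Otherwise n = a^2 b^3 m with b squarefree and a^2 b^3 > v^6.  The union bound
   over (a, b) alone loses a factor 2 in the main term; it is regained because
   4 does not divide m when ab is odd, and m is coprime to 6 when ab is even (a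
   pnd n > 6 is not a multiple of 6). *)

Local Open Scope nat_scope.

(** * The divisor sum and its multiplicativity *)

Lemma leq_sum_sub (I : eqType) (s t : seq I) (F : I -> nat) :
  uniq s -> {subset s <= t} -> \sum_(i <- s) F i <= \sum_(i <- t) F i.
Proof.
move=> us st; apply: (@sub_le_big_seq _ _ leq) => // [x y|i]; first exact: leq_addr.
rewrite count_uniq_mem //; case: (boolP (i \in s)) => // /st.
by rewrite -has_pred1 has_count.
Qed.

Lemma sigmaM_allpairs u v :
  sigma u * sigma v = \sum_(d <- [seq a * b | a <- divisors u, b <- divisors v]) d.
Proof. by rewrite big_allpairs_dep /sigma big_distrlr. Qed.

(** A divisor d of u v splits as gcd(d, u) times a divisor of v, so the products of divisors of u
    and of v cover all divisors of u v. *)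
Lemma sigma_leM u v : 0 < u -> 0 < v -> sigma (u * v) <= sigma u * sigma v.
Proof.
move=> u0 v0; rewrite sigmaM_allpairs.
apply: leq_sum_sub => [|d]; first exact: divisors_uniq.
rewrite -dvdn_divisors ?muln_gt0 ?u0 // => duv.
have d0 : 0 < d by rewrite (dvdn_gt0 _ duv) // muln_gt0 u0.
have g0 : 0 < gcdn d u by rewrite gcdn_gt0 u0 orbT.
apply/allpairsP; exists (gcdn d u, d %/ gcdn d u) => /=.
rewrite -!dvdn_divisors ?dvdn_gcdr //; split=> //; last first.
  by rewrite muln_divA ?dvdn_gcdl // mulKn.
have cop : coprime (d %/ gcdn d u) (u %/ gcdn d u).
  by rewrite /coprime -(eqn_pmul2r g0) muln_gcdl !divnK ?dvdn_gcdl ?dvdn_gcdr ?mul1n.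
rewrite -(Gauss_dvdr _ cop) -(@dvdn_pmul2r (gcdn d u)) //.
by rewrite mulnAC !divnK ?dvdn_gcdl ?dvdn_gcdr.
Qed.

(** By coprimality gcd(u, a b) = a whenever a | u and b | v, so distinct pairs of divisors have
    distinct products. *)
Lemma sigma_geM u v : 0 < u -> 0 < v -> coprime u v ->
  sigma u * sigma v <= sigma (u * v).
Proof.
move=> u0 v0 cuv; rewrite sigmaM_allpairs; apply: leq_sum_sub.
  have gcd_l a b : a %| u -> b %| v -> gcdn u (a * b) = a.
    move=> au bv; rewrite Gauss_gcdl ?(coprime_dvdr bv) //.
    exact/gcdn_idPr.
  apply: allpairs_uniq; rewrite ?divisors_uniq // => -[a b] [a' b'].
  case/allpairsP=> -[a1 b1] /= [+ + [-> ->]].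
  rewrite -!dvdn_divisors // => au bv.
  case/allpairsP=> -[a2 b2] /= [+ + [-> ->]].
  rewrite -!dvdn_divisors // => a'u b'v eab.
  have eaa : a1 = a2 by rewrite -(gcd_l _ _ au bv) eab gcd_l.
  move/eqP: eab; rewrite eaa eqn_pmul2l ?(dvdn_gt0 u0) // => /eqP -> //.
move=> d /allpairsP [[a b] /= [+ + ->]].
by rewrite -!dvdn_divisors ?muln_gt0 ?u0 // => *; apply: dvdn_mul.
Qed.

Lemma sigmaM u v : 0 < u -> 0 < v -> coprime u v ->
  sigma (u * v) = sigma u * sigma v.
Proof.
by move=> u0 v0 cuv; apply/eqP; rewrite eqn_leq sigma_leM ?sigma_geM.
Qed.

Lemma sigma6 : sigma 6 = 12.
Proof. by rewrite /sigma unlock. Qed.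

Lemma sigma1 : sigma 1 = 1.
Proof. by rewrite /sigma unlock. Qed.

Lemma sigma_prime p : prime p -> sigma p = p.+1.
Proof.
move=> pp; have [p1 dp] := primeP pp.
have E : perm_eq (divisors p) [:: 1; p].
  apply: uniq_perm; rewrite ?divisors_uniq //= ?inE ?andbT ?neq_ltn ?p1 //.
  move=> d; rewrite -dvdn_divisors ?prime_gt0 // !inE.
  by apply/idP/idP => [/dp //|/orP[]/eqP->]; rewrite ?dvd1n ?dvdnn.
by rewrite /sigma (perm_big _ E) unlock /= addn0 add1n.
Qed.

Lemma sigma_gt0 n : 0 < n -> 0 < sigma n.
Proof.
move=> n0; rewrite /sigma (big_rem 1) ?divisor1 //.
Qed.

(** * Primitive nondeficient numbers in terms of integer inequalities *)

Lemma nondeficientE n : nondeficient n = (0 < n) && (2 * n <= sigma n).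
Proof.
rewrite /nondeficient /abundancy; case: posnP => //= n0.
by rewrite ler_pdivlMr ?ltr0n // -natrM ler_nat.
Qed.

Lemma deficientE n : deficient n = (0 < n) && (sigma n < 2 * n).
Proof.
rewrite /deficient /abundancy; case: posnP => //= n0.
by rewrite ltr_pdivrMr ?ltr0n // -natrM ltr_nat.
Qed.

Lemma pnd_gt0 n : pnd n -> 0 < n.
Proof. by rewrite /pnd nondeficientE -!andbA => /andP[]. Qed.

Lemma pnd_sigma n : pnd n -> 2 * n <= sigma n.
Proof. by rewrite /pnd nondeficientE -!andbA => /and3P[]. Qed.

Lemma pnd_dvd_sigma n d : pnd n -> d %| n -> d < n -> sigma d < 2 * d.
Proof.
move=> pn dn ltdn; have n0 := pnd_gt0 pn.
move: pn => /andP[_ /allP /(_ d)].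
by rewrite mem_filter ltdn -dvdn_divisors // dn deficientE => /(_ isT) /andP[].
Qed.

Lemma pnd_not_dvd6 n : pnd n -> 6 < n -> ~~ (6 %| n).
Proof.
by move=> pn n6; apply/negP => /(pnd_dvd_sigma pn) /(_ n6); rewrite sigma6.
Qed.

(** * Squarefree numbers and collisions of abundancies *)

Definition sqfree n := (0 < n) && all (fun p => logn p n <= 1) (primes n).

Lemma sqfreeP n : reflect (0 < n /\ forall p, logn p n <= 1) (sqfree n).
Proof.
apply: (iffP andP) => -[n0 h]; split=> //; last by apply/allP => p _.
move=> p; have [/(allP h) //|] := boolP (p \in primes n).
by rewrite -logn_gt0 -eqn0Ngt => /eqP ->.
Qed.

Lemma sqfree_dvd d n : d %| n -> sqfree n -> sqfree d.
Proof.
move=> dn /sqfreeP[n0 h]; apply/sqfreeP; split; first exact: dvdn_gt0 dn.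
by move=> p; apply: leq_trans (dvdn_leq_log p n0 dn) (h p).
Qed.

Lemma sqfree_mulr p d : prime p -> sqfree (p * d) -> coprime p d.
Proof.
move=> pp /sqfreeP[]; rewrite muln_gt0 => /andP[p0 d0] /(_ p).
rewrite lognM // logn_prime // eqxx add1n ltnS leqn0 lognE pp d0 /=.
by case: ifP => // h _; rewrite prime_coprime // h.
Qed.

(** On squarefree d, [sigma] is the product of q + 1 over the primes q | d. *)
Lemma prime_dvd_sigma_sqfree p d : prime p -> sqfree d -> p %| sigma d ->
  exists q, [/\ prime q, q %| d & p %| q.+1].
Proof.
move=> pp; elim/ltn_ind: d => d IH sd.
have [d1|d1] := leqP d 1.
  have /sqfreeP[d0 _] := sd.
  have -> : d = 1 by apply/eqP; rewrite eqn_leq d1.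
  by rewrite sigma1 dvdn1 => /eqP p1; rewrite p1 in pp.
have qp := pdiv_prime d1; have qd := pdiv_dvd d.
set q := pdiv d in qp qd *; case/dvdnP: qd => e de; rewrite mulnC in de.
have e0 : 0 < e by case: e de d1 => // ->; rewrite muln0.
rewrite de sigmaM ?(prime_gt0 qp) //; last by apply: sqfree_mulr; rewrite -?de.
rewrite Euclid_dvdM // (sigma_prime qp) => /orP[pq|pe].
  by exists q; rewrite dvdn_mulr.
have [] := IH e _ _ pe.
- by rewrite de ltn_Pmull ?prime_gt1.
- by apply: sqfree_dvd sd; rewrite de dvdn_mull.
by move=> r [rp re pr]; exists r; rewrite dvdn_mull.

Qed.

Lemma consecutive_primes p : prime p -> prime p.+1 -> p = 2.
Proof.
move=> pp; case: (even_prime pp) => // op /even_prime [e|/=]; last by rewrite op.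
by have := prime_gt1 pp; lia.
Qed.

(** Let p be the largest prime factor of d e. If p divides both numbers, cancel it and induct on d +
    e. If it divides only d, then p | sigma(d), so p | q + 1 for a prime q | d; maximality forces q
    + 1 = p, hence q = 2, p = 3 and 6 | d. *)
Lemma abundancy_inj_sqfree d e : sqfree d -> sqfree e ->
  ~~ (6 %| d) -> ~~ (6 %| e) -> sigma d * e = sigma e * d -> d = e.
Proof.
have [N leN] := ubnP (d + e); elim: N d e leN => // N IH d e.
rewrite ltnS => leN sd se nd ne E.
have /sqfreeP[d0 _] := sd; have /sqfreeP[e0 _] := se.
have [de1|de1] := leqP (d * e) 1.
  have /eqP : d * e = 1 by apply/eqP; rewrite eqn_leq de1 muln_gt0 d0.
  by rewrite muln_eq1 => /andP[/eqP -> /eqP ->].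
wlog pd : d e sd se nd ne E d0 e0 de1 leN / max_pdiv (d * e) %| d.
  move=> H; have := max_pdiv_dvd (d * e).
  rewrite Euclid_dvdM ?max_pdiv_prime // => /orP[|] p_dvd; first exact: H.
  by apply/esym/H; rewrite // 1?mulnC // addnC.
move: (max_pdiv_prime de1) (@max_pdiv_max (d * e)) pd.
move: (max_pdiv _) => p pp pmax pd.
have n6 q a : ~~ (6 %| q * a) -> ~~ (6 %| a) by apply: contra; apply: dvdn_mull.
case/dvdnP: pd => d' dE; rewrite mulnC in dE; subst d.
have [/dvdnP[e' eE]|npe] := boolP (p %| e).
  rewrite mulnC in eE; subst e; congr (p * _).
  move: d0 e0; rewrite !muln_gt0 => /andP[p0 d0] /andP[_ e0].
  have cd := sqfree_mulr pp sd; have ce := sqfree_mulr pp se.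
  apply: IH => //.
  - by apply: leq_trans leN; rewrite -mulnDr ltn_Pmull ?prime_gt1 // addn_gt0 d0.
  - exact: sqfree_dvd (dvdn_mull _ (dvdnn _)) sd.
  - exact: sqfree_dvd (dvdn_mull _ (dvdnn _)) se.
  - exact: n6 nd.
  - exact: n6 ne.
  move: E; rewrite !sigmaM // sigma_prime // => E.
  apply/eqP; rewrite -(@eqn_pmul2l (p.+1 * p)) ?muln_gt0 //.
  by apply/eqP; lia.
have : p %| sigma (p * d') * e by rewrite E mulnCA dvdn_mulr.
rewrite Euclid_dvdM // (negbTE npe) orbF => /(prime_dvd_sigma_sqfree pp sd).
case=> q [qp qd pq].
have qp1 : q <= p by apply: pmax; rewrite mem_primes qp muln_gt0 d0 e0 dvdn_mulr.
have ltqp : q < p.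
  rewrite ltn_neqAle qp1 andbT; apply/eqP => qE.
  by move: pq; rewrite qE -addn1 dvdn_addr // dvdn1 => /eqP p1; rewrite p1 in pp.
have pE : q.+1 = p by apply/eqP; rewrite eqn_leq ltqp dvdn_leq.
have q2 : q = 2 by apply: consecutive_primes; rewrite // pE.
have p3 : p = 3 by rewrite -pE q2.
by case/negP: nd; rewrite (@Gauss_dvd 2 3) // -{1}q2 qd p3 dvdn_mulr.
Qed.

(** Write m = m' p. As m' d is deficient, sigma(m d)/(m d) < 2 (1 + 1/p), while sigma(m e)/(m e) >=
    2. Cancelling sigma(m)/m shows that the abundancy of d is less than 1 + 1/p times that of e, and
    2 d e < p makes this error too small for integers. *)
Lemma erdos_collision_le m d e p : prime p -> p %| m -> 2 * d * e < p ->
  coprime m d -> pnd (m * d) -> pnd (m * e) -> sigma d * e <= sigma e * d.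
Proof.
move=> pp /dvdnP[m' ->] dep cop pd pe.
move: (pnd_gt0 pd) (pnd_gt0 pe); rewrite !muln_gt0.
move=> /andP[/andP[m0 p0] d0] /andP[_ e0].
have hd : sigma (m' * p * d) * p < 2 * (m' * p * d) * p.+1.
  have h1 : sigma (m' * d) < 2 * (m' * d).
    apply: (pnd_dvd_sigma pd); first by rewrite mulnAC dvdn_mulr.
    by rewrite mulnAC ltn_Pmulr ?muln_gt0 ?m0 ?d0 // prime_gt1.
  have := @sigma_leM (m' * d) p; rewrite !muln_gt0 m0 d0 p0 (sigma_prime pp) mulnAC.
  move=> /(_ isT isT) h2.
  rewrite -(mulnC p) [X in _ < X](_ : _ = p * ((2 * (m' * d)) * p.+1)); last by ring.
  by rewrite ltn_pmul2l //; apply: (leq_ltn_trans h2); rewrite ltn_pmul2r.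
have mp0 : 0 < m' * p by rewrite muln_gt0 m0.
have he : 2 * (m' * p * e) <= sigma (m' * p) * sigma e.
  exact: leq_trans (pnd_sigma pe) (sigma_leM _ _).
have se : sigma e < 2 * e.
  apply: (pnd_dvd_sigma pe); rewrite ?dvdn_mull // ltn_Pmull //.
  by apply: leq_trans (prime_gt1 pp) _; rewrite leq_pmull.
rewrite leqNgt; apply/negP => lt.
have h1 : sigma e * d < p.
  apply: leq_ltn_trans dep; rewrite mulnAC leq_mul2r; apply/orP; right.
  exact: ltnW.
have h2 : sigma d * e * p < sigma e * d * p.+1.
  rewrite -(@ltn_pmul2l (sigma (m' * p))) ?sigma_gt0 //.
  apply: (@leq_trans (2 * (m' * p * e) * d * p.+1)).
    move: hd; rewrite sigmaM // -(@ltn_pmul2r e) //.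
    by congr (_ < _); ring.
  rewrite [X in _ <= X](_ : _ = sigma (m' * p) * sigma e * (d * p.+1)); last by ring.
  by rewrite -[X in X <= _]mulnA leq_mul2r he orbT.
(* If sigma(d) e exceeded sigma(e) d, the excess would be at least 1, which is more than sigma(e) d
   / p. *)
have : (sigma e * d).+1 * p <= sigma d * e * p by rewrite leq_mul2r lt orbT.
by move: h1 h2; rewrite mulSn mulnS; lia.
Qed.

(** * Parts of an integer and the shape of squarefull numbers *)

Lemma coprime_primeP a b : 0 < a ->
  (forall q, prime q -> q %| a -> ~~ (q %| b)) -> coprime a b.
Proof.
move=> a0 h; rewrite /coprime eqn_leq gcdn_gt0 a0 andbT leqNgt.
apply/negP => /[dup] g1 /pdiv_prime /h; rewrite !(dvdn_trans (pdiv_dvd _)) ?dvdn_gcdl ?dvdn_gcdr //.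
by move=> /(_ isT).
Qed.

Lemma logn_part_in (pi : nat_pred) q n : 0 < n -> q \in pi -> logn q n`_pi = logn q n.
Proof.
move=> n0 qpi; rewrite -{2}(partnC pi n0) lognM ?part_gt0 //.
suff -> : logn q n`_pi^' = 0 by rewrite addn0.
apply/eqP; rewrite -leqn0 leqNgt logn_gt0.
apply/negP => /(pnatPpi (part_pnat _ _)).
by rewrite inE /= qpi.
Qed.

Lemma dvd_part_in (pi : nat_pred) q n : prime q -> q %| n`_pi -> q \in pi.
Proof.
by move=> qp qn; apply: (pnatPpi (part_pnat pi n)); rewrite mem_primes qp part_gt0.
Qed.

Lemma sq_sqfree_decomp s : 0 < s -> exists u c, [/\ 0 < u, sqfree c & s = c * u ^ 2].
Proof.
elim/ltn_ind: s => s IH s0.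
have [sf|nsf] := boolP (sqfree s); first by exists 1, s; rewrite muln1.
move: nsf; rewrite /sqfree s0 => /allPn[q]; rewrite mem_primes => /and3P[qp _ _].
rewrite -ltnNge => l2.
have : q ^ 2 %| s by rewrite pfactor_dvdn.
case/dvdnP=> t st; have t0 : 0 < t by case: t st s0 => // ->.
have [|//|u [c [u0 cs tE]]] := IH t.
  by rewrite st ltn_Pmulr // -(exp1n 2) ltn_exp2r // prime_gt1.
exists (q * u), c; split=> //; first by rewrite muln_gt0 prime_gt0.
by rewrite st tE expnMn; ring.
Qed.

(** In s = c u^2 with c squarefree, a prime q | c has exponent 1 + 2 [logn q u] in s. As this is at
    least 2, q | u. Hence c | u and s = (u/c)^2 c^3. *)
Lemma squarefull_decomp s : 0 < s -> (forall q, prime q -> q %| s -> q ^ 2 %| s) ->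
  exists a b, [/\ 0 < a, sqfree b & s = a ^ 2 * b ^ 3].
Proof.
move=> s0 full; have [u [c [u0 sc sE]]] := sq_sqfree_decomp s0.
have /sqfreeP[c0 c1] := sc.
have : c %| u.
  apply/dvdn_partP => // q; rewrite mem_primes => /and3P[qp _ qc].
  have lc : logn q c = 1 by apply/eqP; rewrite eqn_leq c1 logn_gt0 mem_primes qp c0.
  rewrite p_part lc expn1.
  have := full q qp; rewrite sE dvdn_mulr // => /(_ isT).
  rewrite pfactor_dvdn ?muln_gt0 ?c0 ?expn_gt0 ?u0 // lognM ?expn_gt0 ?u0 // lc lognX.
  by move=> h; have : 0 < logn q u by [lia]; rewrite logn_gt0 mem_primes => /and3P[].
case/dvdnP=> a uE; exists a, c; split=> //.
  by case: a uE u0 => // ->.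
by rewrite sE uE expnMn; ring.
Qed.

(** * Counting by injections and in residue classes *)

Lemma count_inj (P : pred nat) (Q : nat -> nat -> Prop) N K :
  (forall n, P n -> n <= N -> exists2 m, 0 < m <= K & Q n m) ->
  (forall n n' m, P n -> P n' -> Q n m -> Q n' m -> n = n') ->
  \sum_(1 <= n < N.+1 | P n) 1 <= K.
Proof.
move=> ex inj.
have /choice[f fP] : forall n, exists m, P n -> n <= N -> 0 < m <= K /\ Q n m.
  move=> n; have [Pn|] := boolP (P n); last by exists 0.
  have [nN|] := leqP n N; last by exists 0.
  by have [m mK Qm] := ex n Pn nN; exists m.
rewrite sum1_count -size_filter -(size_map f) -[X in _ <= X](size_iota 1).
apply: uniq_leq_size.
  rewrite map_inj_in_uniq ?filter_uniq ?iota_uniq // => n n'.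
  rewrite !mem_filter !mem_index_iota !ltnS => /and3P[Pn _ nN] /and3P[Pn' _ nN'] E.
  have [_ q1] := fP n Pn nN; have [_ q2] := fP n' Pn' nN'.
  by apply: inj Pn Pn' q1 _; rewrite E.
move=> m /mapP[n]; rewrite mem_filter mem_index_iota ltnS => /and3P[Pn _ nN] ->.
by have [h _] := fP n Pn nN; rewrite mem_iota add1n ltnS.
Qed.

(** The 6 counts 1, 2, 3, 5, 6, 7. Discarding m <= 8 yields the bound 3 K / 4 for every K without an
    error term; the cutoff is available because m will be a multiple of P(n) > 8. *)
Lemma sum_not4 K : 8 <= K ->
  \sum_(1 <= m < K.+1 | (8 < m) && ~~ (4 %| m)) 1 + K %/ 4 + 6 = K.
Proof.
elim: K => // K IH; rewrite leq_eqVlt => /predU1P[<-|].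
  by rewrite unlock.
rewrite ltnS => K8; rewrite big_mkcond big_nat_recr //= -big_mkcond /=.
by have := IH K8; case: ifP; lia.
Qed.

Lemma leq_sum_not4 K : 4 * \sum_(1 <= m < K.+1 | (8 < m) && ~~ (4 %| m)) 1 <= 3 * K.
Proof.
have [/sum_not4|ltK] := leqP 8 K; first by lia.
rewrite big_nat_cond big_pred0 => [|m]; first by lia.
by apply/negbTE/negP; lia.
Qed.

(** The two quotients count the residues 1 and 5 modulo 6; the 3 stands for 1, 5, 7. *)
Lemma sum_coprime6 K : 8 <= K ->
  \sum_(1 <= m < K.+1 | [&& 8 < m, ~~ (2 %| m) & ~~ (3 %| m)]) 1 + 3 = (K + 5) %/ 6 + (K + 1) %/ 6.
Proof.
elim: K => // K IH; rewrite leq_eqVlt => /predU1P[<-|].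
  by rewrite unlock.
rewrite ltnS => K8; rewrite big_mkcond big_nat_recr //= -big_mkcond /=.
by have := IH K8; case: ifP; lia.
Qed.

Lemma leq_sum_coprime6 K :
  3 * \sum_(1 <= m < K.+1 | [&& 8 < m, ~~ (2 %| m) & ~~ (3 %| m)]) 1 <= K.
Proof.
have [/sum_coprime6|ltK] := leqP 8 K; first by lia.
rewrite big_nat_cond big_pred0 => [|m]; first by lia.
by apply/negbTE/negP; lia.
Qed.

(** * Smooth, rough and squarefull parts of a pnd *)

Lemma addn_gt1 a b : 0 < a -> 0 < b -> 1 < a + b.
Proof. by lia. Qed.

Local Open Scope ring_scope.

(** Primes are removed one at a time, k counting them with multiplicity: by submultiplicativity each
    q > Y costs a factor sigma(q)/q <= 1 + 1/Y, and it uses up a factor Y of r. *)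
Lemma sigma_rough (R : realType) (Y : R) r : 0 < Y -> (0 < r)%N ->
  (forall q, prime q -> (q %| r)%N -> Y < q%:R) ->
  exists k, (sigma r)%:R <= r%:R * (1 + Y^-1) ^+ k /\ Y ^+ k <= r%:R.
Proof.
move=> Y0; elim/ltn_ind: r => r IH r0 h.
have [r1|r1] := leqP r 1.
  have -> : r = 1%N by apply/eqP; rewrite eqn_leq r1.
  by exists 0%N; rewrite sigma1 !expr0 mulr1.
have qp := pdiv_prime r1; have := pdiv_dvd r; move: (pdiv r) qp => q qp.
case/dvdnP=> t rE; have t0 : (0 < t)%N by case: t rE r0 => // ->.
have [||u ut|k [h1 h2]] := IH t => //.
- by rewrite rE ltn_Pmulr ?prime_gt1.
- by move=> tu; apply: h => //; rewrite rE dvdn_mulr.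
have Yq : Y < q%:R by apply: h => //; rewrite rE dvdn_mull.
have q0 : 0 < q%:R :> R by apply: lt_trans Yq.
exists k.+1; split; last first.
  by rewrite exprSr rE natrM; apply: ler_pM => //; rewrite ?exprn_ge0 // ltW.
apply: (@le_trans _ _ ((sigma t)%:R * q.+1%:R)).
  by rewrite -natrM ler_nat rE -(sigma_prime qp) sigma_leM // prime_gt0.
rewrite rE natrM exprSr mulrACA; apply: ler_pM => //.
by rewrite mulrDr mulr1 -natr1 lerD2l ler_pdivlMr // mul1r ltW.
Qed.

Definition primes_upto (R : realType) (Y : R) : nat_pred :=
  [pred q : nat | q%:R <= Y].

(** Multiplicity is measured in n. The Y-smooth part D of n has the exponents of n at the primes up
    to Y, so the part of D at these primes is the squarefull part of D. *)
Definition multiple_primes (n : nat) : nat_pred := [pred q : nat | 1 < logn q n]%N.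

Section structure.
Variables (R : realType) (y Y v : R).
Hypotheses (y8 : 8 < y) (Y0 : 0 < Y) (YE : 2 * Y ^+ 2 = y).
Hypotheses (v1 : 1 < v) (vY : v ^+ 6 <= Y).

Let Y_ge2 : 2 <= Y.
Proof. by move: y8 Y0 YE; rewrite expr2 => *; rewrite leNgt; apply/negP => ?; nra. Qed.
Let Y_lty : Y < y.
Proof. by move: Y0 Y_ge2 YE; rewrite expr2 => *; nra. Qed.

Lemma pnd_large_prime n : pnd n -> y < (max_pdiv n)%:R ->
  [/\ prime (max_pdiv n), (max_pdiv n %| n)%N & (8 < max_pdiv n)%N].
Proof.
move=> pn yp.
have p8 : (8 < max_pdiv n)%N by rewrite -(ltr_nat R); apply: lt_trans yp.
split; rewrite ?max_pdiv_dvd //; apply: max_pdiv_prime.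
by apply: leq_trans (max_pdiv_leq (pnd_gt0 pn)); apply: ltn_trans p8.
Qed.

(** The squarefree part [D1] of the smooth part is at least v^3. Let d be its least divisor with d
    >= v^3, and q a prime factor of d. If q >= v^3, minimality gives d <= q <= Y; otherwise d/q <
    v^3, so d < v^6 <= Y. The primes of d occur only once in n, whence coprimality. *)
Lemma pnd_sqfree_part n : pnd n -> y < (max_pdiv n)%:R ->
  v ^+ 9 <= (n`_(primes_upto Y))%N%:R -> (n`_(primes_upto Y)`_(multiple_primes n))%N%:R <= v ^+ 6 ->
  exists m d, [/\ n = (m * d)%N, coprime m d, sqfree d, d%:R <= Y
    & v ^+ 3 <= d%:R].
Proof.
move=> pn yp v9 v6; have n0 := pnd_gt0 pn.
set D := (n`_(primes_upto Y))%N in v9 v6; set D1 := (D`_(multiple_primes n)^')%N.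
have Dn : (D1 %| n)%N by apply: dvdn_trans (dvdn_part _ _) (dvdn_part _ _).
have DE : (D`_(multiple_primes n) * D1)%N = D by apply: partnC; exact: part_gt0.
have v0 : 0 < v := lt_trans ltr01 v1.
have D1v : v ^+ 3 <= D1%:R.
  rewrite -(@ler_pM2l _ (v ^+ 6)) ?exprn_gt0 // -exprD.
  by apply: le_trans v9 _; rewrite -DE natrM ler_wpM2r.
have D1q q : prime q -> (q %| D1)%N -> (logn q n <= 1)%N /\ q%:R <= Y.
  move=> qp qD; split.
    by have := dvd_part_in qp qD; rewrite !inE /= -leqNgt.
  by have := dvd_part_in qp (dvdn_trans qD (dvdn_part _ _)).
have exd : exists d, (d %| D1)%N && (v ^+ 3 <= d%:R) by exists D1; rewrite dvdnn.
case: (ex_minnP exd) => d /andP[dD dv] dmin.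
have d0 : (0 < d)%N by apply: dvdn_gt0 dD; rewrite part_gt0.
have v3 : 1 < v ^+ 3 by rewrite exprn_egt1.
have sd : sqfree d.
  apply/sqfreeP; split=> // q.
  have [qd|] := boolP (q \in primes d); last by rewrite -logn_gt0 -eqn0Ngt => /eqP ->.
  move: qd; rewrite mem_primes => /and3P[qp _ qd].
  have [h _] := D1q q qp (dvdn_trans qd dD).
  by apply: leq_trans (dvdn_leq_log _ n0 (dvdn_trans dD Dn)) h.
have dn := dvdn_trans dD Dn.
have nd0 : (0 < n %/ d)%N by rewrite divn_gt0 //; apply: dvdn_leq.
exists (n %/ d)%N, d; split=> //; first by rewrite divnK.
  rewrite coprime_sym; apply: coprime_primeP => // q qp qd.
  have [h _] := D1q q qp (dvdn_trans qd dD).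
  apply/negP => qnd; move: h; rewrite -(divnK dn) lognM //.
  rewrite leqNgt => /negP; apply.
  by apply: addn_gt1; rewrite logn_gt0 mem_primes qp ?nd0 ?d0.
have d1 : (1 < d)%N by rewrite -(ltr_nat R); apply: lt_le_trans dv.
have qp := pdiv_prime d1; have := pdiv_dvd d; move: (pdiv d) qp => q qp qd.
have [_ qY] := D1q q qp (dvdn_trans qd dD).
have [vq|qv] := leP (v ^+ 3) q%:R.
  by apply: le_trans qY; rewrite ler_nat dmin // vq (dvdn_trans qd dD).
apply: le_trans vY; rewrite -(divnK qd) natrM -[6%N]/(3 + 3)%N exprD.
apply: ler_pM => //; last exact: ltW.
rewrite leNgt; apply/negP => /ltW h.
have := dmin (d %/ q)%N; rewrite h andbT (dvdn_trans _ dD); last first.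
  by rewrite -{2}(divnK qd) dvdn_mulr.
by move=> /(_ isT); rewrite leqNgt ltn_Pdiv ?prime_gt1.
Qed.

Lemma pnd_squarefull_part n : pnd n -> y < (max_pdiv n)%:R ->
  v ^+ 6 < (n`_(primes_upto Y)`_(multiple_primes n))%N%:R ->
  exists a b m, [/\ n = (a ^ 2 * b ^ 3 * m)%N, (0 < a)%N, sqfree b,
    v ^+ 6 < (a ^ 2 * b ^ 3)%:R & (8 < m)%N /\
    if odd (a * b) then ~~ (4 %| m)%N else ~~ (2 %| m)%N && ~~ (3 %| m)%N].
Proof.
move=> pn yp; have n0 := pnd_gt0 pn.
have [pp pdn p8] := pnd_large_prime pn yp.
set D := (n`_(primes_upto Y))%N; set s := (D`_(multiple_primes n))%N => vs.
have s0 : (0 < s)%N by exact: part_gt0.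
have sD : (s %| D)%N by exact: dvdn_part.
have sn : (s %| n)%N by apply: dvdn_trans sD (dvdn_part _ _).
have m0 : (0 < n %/ s)%N by rewrite divn_gt0 //; apply: dvdn_leq.
have sq q : prime q -> (q %| s)%N -> logn q s = logn q n /\ (1 < logn q n)%N.
  move=> qp qs; have h := dvd_part_in qp qs.
  have h2 := dvd_part_in qp (dvdn_trans qs sD).
  by rewrite !logn_part_in ?part_gt0.
have cop : coprime s (n %/ s).
  apply: coprime_primeP => // q qp qs; apply/negP => qm.
  have [h _] := sq q qp qs; move: h.
  rewrite -(divnK sn) lognM // -[LHS]add0n => /eqP.
  rewrite eqn_add2r => /eqP h; have : (0 < logn q (n %/ s))%N.
    by rewrite logn_gt0 mem_primes qp m0.
  by rewrite -h.
have [|a [b [a0 sb sE]]] := @squarefull_decomp s s0.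
  move=> q qp qs; have [h1 h2] := sq q qp qs.
  by rewrite pfactor_dvdn // h1.
exists a, b, (n %/ s)%N; rewrite -sE mulnC divnK //; split=> //; split.
  (* The primes of s are at most Y < P(n), so P(n) divides the cofactor. *)
  apply: leq_trans p8 (dvdn_leq m0 _).
  move: pdn; rewrite -{2}(divnK sn) Euclid_dvdM // => /orP[//|ps].
  have := dvd_part_in pp (dvdn_trans ps sD).
  by rewrite inE /= => /le_lt_trans /(_ Y_lty) /lt_trans /(_ yp); rewrite ltxx.
have oddE : odd (a * b) = odd s by rewrite sE oddM [in RHS]oddM !oddX.
rewrite oddE; case: ifP => os.
  (* Since 2 <= Y, a factor 4 of the cofactor would put the prime 2 into the squarefull part s,
     which is odd here. *)
  apply/negP => m4; have l2 : (1 < logn 2 n)%N.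
    rewrite -pfactor_dvdn // -(divnK sn); exact: dvdn_mulr.
  have : (2 %| s)%N.
    have : (0 < logn 2 s)%N by rewrite !logn_part_in ?part_gt0 // ltnW.
    by rewrite logn_gt0 mem_primes => /and3P[].
  by rewrite dvdn2 os.
have s2 : (2 %| s)%N by rewrite dvdn2 os.
have m2 : ~~ (2 %| n %/ s)%N by rewrite -prime_coprime // (coprime_dvdl s2).
rewrite m2 /=; apply: contra (@pnd_not_dvd6 n pn _) => [m3|].
  by rewrite (@Gauss_dvd 2 3) // (dvdn_trans s2 sn) -(divnK sn) dvdn_mulr.
by apply: leq_trans (max_pdiv_leq n0); apply: ltn_trans p8.
Qed.

End structure.

(** * The case of a small squarefull part *)

Lemma count_sqfree_part (R : realType) (x y Y v : R) :
  8 < y -> 0 < Y -> 2 * Y ^+ 2 = y -> 1 < v -> v ^+ 6 <= Y -> 0 <= x ->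
  (forall n, pnd n -> y < (max_pdiv n)%:R -> n%:R <= x -> v ^+ 9 <= (n`_(primes_upto Y))%N%:R) ->
  ((\sum_(1 <= n < (Num.truncn x).+1 | [&& pnd n, (y < (max_pdiv n)%:R)%R
     & ((n`_(primes_upto Y)`_(multiple_primes n))%N%:R <= v ^+ 6)%R]) 1)%N)%:R <= x / v ^+ 3.
Proof.
move=> y8 Y0 YE v1 vY x0 smooth_ge.
have v3 : 0 < v ^+ 3 by rewrite exprn_gt0 // (lt_trans ltr01).
have xv0 : 0 <= x / v ^+ 3 by rewrite divr_ge0 // ltW.
rewrite -truncn_ge_nat //.
pose Q n m := exists d, [/\ n = (m * d)%N, coprime m d, sqfree d, d%:R <= Y
    & v ^+ 3 <= d%:R].
apply: (@count_inj _ Q) => [n /and3P[pn yp sv] nN|].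
  have nx : n%:R <= x by rewrite -truncn_ge_nat.
  have [m [d [nE cop sd dY dv]]] :=
    pnd_sqfree_part v1 vY pn yp (smooth_ge n pn yp nx) sv.
  exists m; last by exists d.
  have := pnd_gt0 pn; rewrite nE muln_gt0 => /andP[-> d0] /=.
  rewrite truncn_ge_nat // ler_pdivlMr //; apply: le_trans nx.
  by rewrite nE natrM ler_wpM2l.
move=> n n' m /and3P[pn yp _] /and3P[pn' yp' _] [d [nE cop sd dY _]] [e [nE' cop' se eY _]].
have Yy : Y < y by nra.
have [pp pdn p8] := pnd_large_prime y8 pn yp.
have n0 := pnd_gt0 pn; have n0' := pnd_gt0 pn'.
(* As d <= Y < P(n), the prime P(n) divides the common cofactor m; it serves for both directions of
   the comparison of d and e. *)
have pm : (max_pdiv n %| m)%N.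
  move: pdn; rewrite {2}nE Euclid_dvdM // => /orP[//|pd].
  have d0 : (0 < d)%N by move: n0; rewrite nE muln_gt0 => /andP[].
  have := dvdn_leq d0 pd; rewrite -(ler_nat R) => h.
  by have := lt_le_trans yp (le_trans h dY); rewrite ltNge ltW.
have n6 : (6 < n)%N.
  by apply: leq_trans (max_pdiv_leq n0); apply: ltn_trans p8.
have [pp' pdn' p8'] := pnd_large_prime y8 pn' yp'.
have n6' : (6 < n')%N.
  by apply: leq_trans (max_pdiv_leq n0'); apply: ltn_trans p8'.
(* This is what Y^2 = y/2 is chosen for: 2 d e <= 2 Y^2 = y < P(n). *)
have de : (2 * d * e < max_pdiv n)%N.
  rewrite -(ltr_nat R); apply: le_lt_trans yp; rewrite -YE -mulnA natrM ler_wpM2l //.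
  by rewrite natrM expr2 ler_pM.
have nd := pnd_not_dvd6 pn n6; have ne := pnd_not_dvd6 pn' n6'.
suff eqde : d = e by rewrite nE nE' eqde.
apply: abundancy_inj_sqfree => //.
- by apply: contra nd; rewrite nE; exact: dvdn_mull.
- by apply: contra ne; rewrite nE'; exact: dvdn_mull.
rewrite nE in pn pm pp de; rewrite nE' in pn'.
apply/eqP; rewrite eqn_leq (erdos_collision_le pp pm) // (erdos_collision_le pp pm) //.
by rewrite mulnAC.
Qed.

(** * Sums of inverse squares and inverse cubes *)

Lemma sum_inv_sq_residue (R : realType) (t : R) q r N : 0 < t -> (0 < q)%N ->
  \sum_(1 <= a < N.+1 | (a %% q == r)%N && (t < a%:R)) (a%:R ^+ 2)^-1
    <= (q%:R * t)^-1 + Num.min 1 (t ^+ 2)^-1.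
Proof.
move=> t0 q0; set c := Num.min _ _.
pose S (N : nat) : R := \sum_(1 <= a < N.+1 | (a %% q == r)%N && (t < a%:R)) (a%:R ^+ 2)^-1.
have c0 : 0 <= c by rewrite le_min ler01 invr_ge0 sqr_ge0.
have qR : 0 < q%:R :> R by rewrite ltr0n.
have SS n : S n.+1 = S n + (if (n.+1 %% q == r)%N && (t < n.+1%:R) then (n.+1%:R ^+ 2)^-1 else 0).
  by rewrite /S big_mkcond big_nat_recr //= -big_mkcond.
rewrite -/(S N).
(* Here a is the last index summed so far and 1/(q a) is kept in reserve: the next index m >= a + q
   satisfies 1/m^2 <= 1/(q a) - 1/(q m). The first term is paid for by [c]. *)
suff [->|[a [a0 _ _ h]]] : S N = 0 \/ exists a : nat, [/\ (0 < a)%N, (a <= N)%N, (a %% q = r)%N &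
    S N <= (q%:R * t)^-1 + c - (q%:R * a%:R)^-1].
- by rewrite addr_ge0 // invr_ge0 mulr_ge0 // ltW.
- by apply: le_trans h _; rewrite gerDl oppr_le0 invr_ge0 mulr_ge0.
elim: N => [|n IH]; first by left; rewrite /S big_geq.
rewrite SS; case: ifP => [/andP[/eqP nr tn]|_]; last first.
  rewrite addr0; case: IH => [|[a [a0 an ar h]]]; [by left|right].
  by exists a; rewrite leqW.
right; exists n.+1; split=> //.
have n0 : 0 < n.+1%:R :> R by rewrite ltr0n.
case: IH => [->|[a [a0 an ar h]]].
  rewrite add0r addrAC -[leLHS]add0r lerD //.
    rewrite subr_ge0 lef_pV2 ?posrE ?mulr_gt0 // ler_pM2l //; exact: ltW.
  rewrite le_min; apply/andP; split.
    by rewrite invf_le1 ?exprn_gt0 // -natrX ler1n expn_gt0.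
  by rewrite lef_pV2 ?posrE ?exprn_gt0 // lerXn2r ?nnegrE ?(ltW t0) ?(ltW n0) ?(ltW tn).
have aR : 0 < a%:R :> R by rewrite ltr0n.
have aq : (a + q <= n.+1)%N.
  have aE : (a %/ q < n.+1 %/ q)%N.
    rewrite ltnNge; apply/negP => h'.
    have : (n.+1 <= a)%N by rewrite (divn_eq n.+1 q) (divn_eq a q) nr ar leq_add2r leq_mul2r h' orbT.
    by rewrite leqNgt ltnS an.
  by rewrite (divn_eq n.+1 q) (divn_eq a q) nr ar addnAC leq_add2r -mulSnr leq_mul2r aE orbT.
have {aq}aq : a%:R + q%:R <= n.+1%:R :> R by rewrite -natrD ler_nat.
move: (n.+1%:R) n0 aq => m m0 aq.
apply: le_trans (lerD h (lexx _)) _; rewrite -addrA lerD2l.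
rewrite -subr_ge0.
have -> : - (q%:R * m)^-1 - (- (q%:R * a%:R)^-1 + (m ^+ 2)^-1) =
   (m * (m - a%:R) - q%:R * a%:R) / (q%:R * a%:R * m ^+ 2).
  by field; rewrite !gt_eqF.
apply: divr_ge0; last by rewrite !mulr_ge0 ?sqr_ge0 // ltW.
rewrite subr_ge0 mulrC; apply: ler_pM; rewrite ?(ltW aR) ?(ltW qR) //.
  by apply: le_trans aq; rewrite lerDl ltW.
by rewrite lerBrDl.
Qed.

Lemma sum_min_inv_cube (R : realType) (B : R) N : 0 < B ->
  \sum_(1 <= b < N.+1) Num.min (b%:R ^+ 3)^-1 (B ^+ 3)^-1 <= 3 / 2 / B ^+ 2.
Proof.
move=> B0; pose S (N : nat) : R := \sum_(1 <= b < N.+1) Num.min (b%:R ^+ 3)^-1 (B ^+ 3)^-1.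
have SS n : S n.+1 = S n + Num.min (n.+1%:R ^+ 3)^-1 (B ^+ 3)^-1.
  by rewrite /S big_nat_recr.
rewrite -/(S N).
(* The terms up to B give at most 1/B^2 and the later ones telescope against 1/(2 N^2), whence the
   constant 1 + 1/2. *)
have [h1 h2] : (N%:R <= B -> S N <= N%:R / B ^+ 3) /\
   (B <= N%:R -> S N <= 3 / 2 / B ^+ 2 - (2 * N%:R ^+ 2)^-1).
  elim: N => [|n [IH1 IH2]]; first by split; rewrite ?[_ <= 0]leNgt ?B0 // /S big_geq // mul0r.
  rewrite SS; set m := n.+1%:R; have mE : m = n%:R + 1 by rewrite /m -natr1.
  have n0 : 0 <= n%:R :> R by [].
  split=> mB.
    have -> : m / B ^+ 3 = n%:R / B ^+ 3 + (B ^+ 3)^-1 by rewrite mE mulrDl mul1r.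
    by apply: lerD; [apply: IH1; lra|rewrite ge_min lexx orbT].
  have m0 : 0 < m by lra.
  have hm : Num.min (m ^+ 3)^-1 (B ^+ 3)^-1 <= (m ^+ 3)^-1 by rewrite ge_min lexx.
  have [nB|Bn] := leP n%:R B.
    apply: le_trans (lerD (IH1 nB) hm) _.
    rewrite -subr_ge0.
    have -> : 3 / 2 / B ^+ 2 - (2 * m ^+ 2)^-1 - (n%:R / B ^+ 3 + (m ^+ 3)^-1) =
      (m - B) * (m * B * (m + B) + 2 * (m ^+ 2 + m * B + B ^+ 2) - 2 * m ^+ 3)
        / (2 * m ^+ 3 * B ^+ 3).
      by rewrite mE; field; rewrite -mE !gt_eqF.
    apply: divr_ge0; last by rewrite !mulr_ge0 ?exprn_ge0 // ltW.
    apply: mulr_ge0; first by rewrite subr_ge0.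
    (* At the crossing n <= B <= n + 1, writing B = n + s with s >= 0 leaves a polynomial with
       nonnegative coefficients. *)
    have -> : B = n%:R + (B - n%:R) by ring.
    have s0 : 0 <= B - n%:R by rewrite subr_ge0.
    move: (B - n%:R) s0 => s s0; rewrite mE; move: (n%:R) n0 => k k0.
    have -> : (k + 1) * (k + s) * (k + 1 + (k + s)) +
        2 * ((k + 1) ^+ 2 + (k + 1) * (k + s) + (k + s) ^+ 2) - 2 * (k + 1) ^+ 3 =
      k * (3 * k + 1) + s * (3 * k ^+ 2 + 10 * k + 3 + s * (k + 3)).
      by ring.
    by rewrite !(addr_ge0, mulr_ge0, exprn_ge0).
  apply: le_trans (lerD (IH2 (ltW Bn)) hm) _.
  rewrite -addrA lerD2l -subr_ge0.
  have n1 : 0 < n%:R :> R by apply: lt_trans Bn.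
  have -> : - (2 * m ^+ 2)^-1 - (- (2 * n%:R ^+ 2)^-1 + (m ^+ 3)^-1) =
     (3 * n%:R + 1) / (2 * n%:R ^+ 2 * m ^+ 3).
    by rewrite mE; field; rewrite -mE !gt_eqF.
  by apply: divr_ge0; rewrite ?addr_ge0 ?mulr_ge0 ?exprn_ge0 // ltW.
have B2 : 0 < (B ^+ 2)^-1 by rewrite invr_gt0 exprn_gt0.
have [NB|/ltW /h2 h] := leP N%:R B; last first.
  by apply: le_trans h _; rewrite gerDl oppr_le0 invr_ge0 mulr_ge0 ?exprn_ge0.
apply: le_trans (h1 NB) _.
have -> : N%:R / B ^+ 3 = N%:R / B / B ^+ 2 by field; rewrite gt_eqF.
rewrite ler_pM2r //; apply: (@le_trans _ _ 1); last by lra.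
by rewrite ler_pdivrMr // mul1r.
Qed.

Lemma ler_sum_sub (R : numDomainType) (I : eqType) (s t : seq I) (F : I -> R) :
  uniq s -> uniq t -> {subset s <= t} -> (forall i, 0 <= F i) ->
  \sum_(i <- s) F i <= \sum_(i <- t) F i.
Proof.
move=> us ut st F0; rewrite [leRHS](bigID (fun i => i \in s)) /=.
rewrite -[X in _ <= X + _]big_filter.
have E : perm_eq [seq i <- t | i \in s] s.
  apply: uniq_perm; rewrite ?filter_uniq // => i; rewrite mem_filter.
  by case: (boolP (i \in s)) => // /st.
by rewrite (perm_big _ E) lerDl; apply: sumr_ge0.
Qed.

(** * Zeta values and sums over squarefree numbers *)

Section zeta.
Variable R : realType.

(** The weight left on b after summing 1/(a^2 b^3) over a > t = v^3 b^(-3/2): the sum is about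
    b^(-3) / t = b^(-3/2) / v^3. *)
Definition pow32 (n : nat) : R := n%:R `^ (- (3 / 2)).

Lemma pow32_ge0 n : 0 <= pow32 n. Proof. exact: powR_ge0. Qed.

Lemma pow32_gt0 n : (0 < n)%N -> 0 < pow32 n.
Proof. by move=> n0; rewrite powR_gt0 // ltr0n. Qed.

Lemma pow32M m n : pow32 (m * n) = pow32 m * pow32 n.
Proof. by rewrite /pow32 natrM powRM. Qed.

Lemma pow32_sqr n : pow32 (n ^ 2) = n%:R `^ (- 3).
Proof.
rewrite /pow32 natrX -powR_mulrn // -powRrM; congr (_ `^ _); by field.
Qed.

Lemma powRN3 n : (0 < n)%N -> n%:R `^ (- 3) = (n%:R ^+ 3)^-1 :> R.
Proof. by move=> n0; rewrite powRN -powR_mulrn. Qed.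

Lemma sqr_pow32 n : (0 < n)%N -> pow32 n ^+ 2 = (n%:R ^+ 3)^-1.
Proof. by move=> n0; rewrite expr2 -pow32M -(powRN3 n0) -pow32_sqr. Qed.

Lemma pow32E n : (0 < n)%N -> pow32 n = (Num.sqrt n%:R ^+ 3)^-1.
Proof.
move=> n0; apply/eqP; rewrite -(@eqrXn2 _ 2) ?pow32_ge0 ?invr_ge0 ?exprn_ge0 //.
by rewrite sqr_pow32 // exprVn -exprM mulnC exprM sqr_sqrtr.
Qed.

Lemma sum_pow32_le N : \sum_(1 <= n < N.+1) pow32 n <= 3.
Proof.
pose S (N : nat) : R := \sum_(1 <= n < N.+1) pow32 n.
have SS n : S n.+1 = S n + pow32 n.+1 by rewrite /S big_nat_recr.
rewrite -/(S N); case: N => [|N]; first by rewrite /S big_geq.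
(* Equality holds for the one-term sum; after that n^(-3/2) <= 2 / sqrt(n - 1) - 2 / sqrt(n)
   telescopes. *)
suff h : S N.+1 <= 3 - 2 / Num.sqrt N.+1%:R.
  by apply: le_trans h _; rewrite gerDl oppr_le0 divr_ge0.
elim: N => [|n IH]; first by rewrite SS /S big_geq // add0r /pow32 powR1 sqrtr1; lra.
rewrite SS pow32E //; apply: le_trans (lerD IH (lexx _)) _.
set p := Num.sqrt n.+1%:R; set q := Num.sqrt n.+2%:R.
have p0 : 0 < p by rewrite sqrtr_gt0 ltr0n.
have q0 : 0 < q by rewrite sqrtr_gt0 ltr0n.
have qp : q ^+ 2 = p ^+ 2 + 1 by rewrite !sqr_sqrtr // natr1.
have pq : p <= q by rewrite ler_sqrt ?ler_nat.
rewrite -addrA lerD2l -subr_ge0.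
have -> : - (2 / q) - (- (2 / p) + (q ^+ 3)^-1) = (2 * q ^+ 2 * (q - p) - p) / (p * q ^+ 3).
  by field; rewrite !gt_eqF.
apply: divr_ge0; last by rewrite mulr_ge0 ?exprn_ge0 // ltW.
rewrite subr_ge0 -(@ler_pM2r _ (q + p)) ?addr_gt0 //.
have -> : 2 * q ^+ 2 * (q - p) * (q + p) = 2 * q ^+ 2 * (q ^+ 2 - p ^+ 2) by ring.
by rewrite qp; nra.
Qed.

Lemma zeta_cvg (s : R) : 3 / 2 <= s -> cvgn (series (fun k : nat => k.+1%:R `^ (- s))).
Proof.
move=> hs; apply: nondecreasing_is_cvgn.
  by apply: nondecreasing_series => n _ _; exact: powR_ge0.
exists 3 => _ [n _ <-]; apply: le_trans (sum_pow32_le n).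
rewrite big_add1 /= /series /=; apply: ler_sum => k _.
by rewrite ler_powR ?lerN2 // ler1n.
Qed.

Lemma le_zeta (s : R) N : 3 / 2 <= s -> \sum_(1 <= n < N.+1) n%:R `^ (- s) <= zeta s.
Proof.
move=> hs; rewrite big_add1 /=; apply: nondecreasing_cvgn_le (zeta_cvg hs) _.
by apply: nondecreasing_series => n _ _; exact: powR_ge0.
Qed.

Lemma zeta3_gt0 : 0 < zeta (3 : R).
Proof.
have h : 3 / 2 <= 3 :> R by lra.
apply: lt_le_trans (le_zeta 1 h); rewrite big_nat1 powR1; exact: ltr01.
Qed.

(** The exponents of b are 0 or 1, so they are the parities of those of b k^2. *)
Lemma sqfree_mul_sqr_inj b c k l : sqfree b -> sqfree c -> (0 < k)%N -> (0 < l)%N ->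
  (b * k ^ 2 = c * l ^ 2)%N -> b = c /\ k = l.
Proof.
move=> /sqfreeP[b0 b1] /sqfreeP[c0 c1] k0 l0 E.
have bc : b = c.
  apply: eqn_from_log => // p; have := congr1 (logn p) E.
  rewrite !lognM ?muln_gt0 ?k0 ?l0 //.
  by have := b1 p; have := c1 p; lia.
split=> //; move/eqP: E; rewrite bc eqn_pmul2l // => /eqP E.
by apply/eqP; rewrite -eqn_sqr E.
Qed.

(** Since b^(-3/2) k^(-3) = (b k^2)^(-3/2) and (b, k) |-> b k^2 is injective for squarefree b, the
    product expands into distinct terms of the series at 3/2. *)
Lemma sum_sqfree_mul_zeta3 N :
  (\sum_(1 <= b < N.+1 | sqfree b) pow32 b) * zeta 3 <= zeta (3 / 2 : R).
Proof.
set F := \sum_(_ <= b < _ | _) _.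
have F0 : 0 <= F by apply: sumr_ge0 => *; exact: pow32_ge0.
have h3 : 3 / 2 <= 3 :> R by lra.
(* Dividing by a nonzero F reduces the claim to a bound on every partial sum of the series at 3. *)
have [->|Fn0] := eqVneq F 0.
  by rewrite mul0r; apply: le_trans (le_zeta 0 (lexx _)); rewrite big_geq.
have {}F0 : 0 < F by rewrite lt_neqAle eq_sym Fn0.
rewrite mulrC -ler_pdivlMr //; apply: limr_le; first exact: zeta_cvg.
apply: nearW => K; rewrite ler_pdivlMr // /series /= mulrC.
have -> : \sum_(0 <= k < K) k.+1%:R `^ (- 3) = \sum_(1 <= k < K.+1) pow32 (k ^ 2).
  by rewrite big_add1 /=; apply: eq_bigr => k _; rewrite pow32_sqr.
rewrite /F -big_filter big_distrlr /=.
under eq_bigr do under eq_bigr do rewrite -pow32M.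
rewrite -(big_allpairs_dep (h := fun b k => b * k ^ 2)%N).
apply: le_trans (le_zeta (N * K ^ 2) (lexx _)).
apply: ler_sum_sub; rewrite ?iota_uniq //.
- apply: allpairs_uniq; rewrite ?filter_uniq ?iota_uniq // => -[b k] [c l].
  case/allpairsP=> -[b1 k1] /= [+ + [-> ->]].
  rewrite mem_filter !mem_index_iota => /andP[sb _] /andP[k0 _].
  case/allpairsP=> -[b2 k2] /= [+ + [-> ->]].
  rewrite mem_filter !mem_index_iota => /andP[sc _] /andP[l0 _].
  by move=> /(sqfree_mul_sqr_inj sb sc k0 l0)[-> ->].
- move=> n /allpairsP[[b k] /= [+ + ->]].
  rewrite mem_filter !mem_index_iota !ltnS => /and3P[_ b0 bN] /andP[k0 kK].
  by rewrite muln_gt0 b0 expn_gt0 k0 leq_mul // leq_exp2r.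
- by move=> n; exact: powR_ge0.
Qed.

Lemma sum_sqfree_le_lambda N : \sum_(1 <= b < N.+1 | sqfree b) pow32 b <= 2 * lambda R.
Proof.
have z3 := zeta3_gt0; rewrite /lambda.
have -> : 2 * (zeta (3 / 2) / (2 * zeta 3)) = zeta (3 / 2 : R) / zeta 3.
  by field; rewrite gt_eqF.
by rewrite ler_pdivlMr // sum_sqfree_mul_zeta3.
Qed.

Lemma pow32_2_ge : 1 / 4 <= pow32 2.
Proof.
rewrite -(@ler_pXn2r _ 2) ?nnegrE ?pow32_ge0 ?divr_ge0 //.
by rewrite sqr_pow32 //; lra.
Qed.

(* With O(N) and E(N) the two sums, doubling an odd number gives
   O(N) <= 4 E(2N), whence 13/24 O(N) + 1/3 E(2N) <= (O(2N) + E(2N)) / 2. *)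
Lemma sum_odd_even_sqfree N :
  13 / 24 * (\sum_(1 <= b < N.+1 | sqfree b && odd b) pow32 b)
   + 1 / 3 * (\sum_(1 <= b < N.+1 | sqfree b && ~~ odd b) pow32 b) <= lambda R.
Proof.
pose O n : R := \sum_(1 <= b < n.+1 | sqfree b && odd b) pow32 b.
pose E n : R := \sum_(1 <= b < n.+1 | sqfree b && ~~ odd b) pow32 b.
rewrite -/(O N) -/(E N).
have OE n : O n + E n <= 2 * lambda R.
  by apply: le_trans (sum_sqfree_le_lambda n); rewrite [leRHS](bigID odd).
have mono (P : pred nat) n : \sum_(1 <= b < n.+1 | P b) pow32 b <= \sum_(1 <= b < (2 * n).+1 | P b) pow32 b.
  rewrite -!(big_filter (index_iota _ _)); apply: ler_sum_sub.
  - by rewrite filter_uniq ?iota_uniq.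
  - by rewrite filter_uniq ?iota_uniq.
  - move=> b; rewrite !mem_filter !mem_index_iota => /and3P[-> -> /=]; lia.
  - exact: pow32_ge0.
have EN : O N / 4 <= E (2 * N)%N.
  apply: (@le_trans _ _ (pow32 2 * O N)).
    rewrite mulrC; apply: ler_wpM2r; last by have := pow32_2_ge; lra.
    by apply: sumr_ge0 => *; exact: pow32_ge0.
  rewrite /O /E mulr_sumr; under eq_bigr do rewrite -pow32M.
  rewrite -!(big_filter (index_iota _ _)) -(big_map (muln 2) xpredT pow32).
  apply: ler_sum_sub.
  - by rewrite map_inj_uniq ?filter_uniq ?iota_uniq // => a b; lia.
  - by rewrite filter_uniq ?iota_uniq.
  - move=> _ /mapP[b + ->]; rewrite !mem_filter !mem_index_iota => /and3P[/andP[sb ob] b0 bN].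
    rewrite oddM /= andbT; apply/andP; split; last by lia.
    have /sqfreeP[_ b1] := sb.
    apply/sqfreeP; split=> [|p]; first by lia.
    have [p2|pn2] := eqVneq p 2%N.
      rewrite p2 lognM // logn_prime // eqxx logn_coprime ?addn0 //.
      by rewrite prime_coprime // dvdn2 ob.
    by rewrite lognM // logn_prime // (negbTE pn2) add0n; exact: b1.
  - exact: pow32_ge0.
have := OE (2 * N)%N; have := mono (fun b => sqfree b && ~~ odd b) N.
have := mono (fun b => sqfree b && odd b) N.
by rewrite -/(O N) -/(E N) -/(O _) -/(E _); lra.
Qed.

End zeta.

(** * The case of a large squarefull part *)

Definition cofactor_ok (o : bool) (m : nat) : bool :=
  (8 < m)%N && (if o then ~~ (4 %| m)%N else ~~ (2 %| m)%N && ~~ (3 %| m)%N).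

(** The densities of the non-multiples of 4 and of the integers coprime to 6; [o] is the parity of a
    b. *)
Definition density (R : realType) (o : bool) : R := if o then 3 / 4 else 1 / 3.

Lemma count_cofactor (R : realType) o K :
  (\sum_(1 <= m < K.+1 | cofactor_ok o m) 1)%N%:R <= density R o * K%:R.
Proof.
rewrite /cofactor_ok /density; case: o.
  by have := leq_sum_not4 K; rewrite -(ler_nat R) !natrM; lra.
by have := leq_sum_coprime6 K; rewrite -(ler_nat R) natrM; lra.
Qed.

Section squarefull.
Variables (R : realType) (v : R).
Hypothesis v0 : 0 < v.

Let inv_large (b a : nat) : R :=
  if v ^+ 6 < (a ^ 2 * b ^ 3)%:R then ((a ^ 2 * b ^ 3)%:R)^-1 else 0.

(** The first-term bound of [sum_inv_sq_residue] divided by b^3: for t = v^3 b^(-3/2), min(1, 1/t^2)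
    / b^3 = min(1/b^3, 1/v^6). Writing v^6 as (v^2)^3 fits [sum_min_inv_cube] at B = v^2. *)
Let minb (b : nat) : R := Num.min (b%:R ^+ 3)^-1 ((v ^+ 2) ^+ 3)^-1.

Lemma sum_inv_large_residue q r b N : (0 < b)%N -> (0 < q)%N ->
  \sum_(1 <= a < N.+1 | (a %% q)%N == r) inv_large b a
    <= pow32 R b / v ^+ 3 / q%:R + minb b.
Proof.
move=> b0 q0; have z0 := pow32_gt0 R b0.
have b3 : 0 < b%:R ^+ 3 :> R by rewrite exprn_gt0 // ltr0n.
have v3 : 0 < v ^+ 3 by rewrite exprn_gt0.
have qR : 0 < q%:R :> R by rewrite ltr0n.
have t0 : 0 < v ^+ 3 * pow32 R b by rewrite mulr_gt0.
(* A square root turns a^2 b^3 > v^6 into a threshold on a alone. *)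
have large a : (v ^+ 6 < (a ^ 2 * b ^ 3)%:R) = (v ^+ 3 * pow32 R b < a%:R).
  rewrite -[RHS](@ltr_pXn2r _ 2) ?nnegrE ?(ltW t0) // exprMn sqr_pow32 // -exprM.
  by rewrite ltr_pdivrMr // natrM !natrX.
have := @sum_inv_sq_residue R _ q r N t0 q0.
rewrite -(@ler_pM2r _ (b%:R ^+ 3)^-1) ?invr_gt0 // mulr_suml => h.
apply: le_trans (le_trans _ h) _; rewrite ?[leLHS]big_mkcond ?[leRHS]big_mkcond /=.
  rewrite le_eqVlt; apply/orP; left; apply/eqP; apply: eq_bigr => a _.
  rewrite /inv_large large; case: eqP => //= _; case: ifP => // _.
  by rewrite natrM !natrX invfM.
rewrite mulrDl; apply: lerD.
  rewrite -sqr_pow32 // le_eqVlt; apply/orP; left; apply/eqP.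
  by field; rewrite !gt_eqF.
have c0 : 0 <= (b%:R ^+ 3)^-1 :> R by rewrite invr_ge0 ltW.
rewrite le_min; apply/andP; split.
  by rewrite -[leRHS]mul1r; apply: ler_wpM2r; rewrite // ge_min lexx.
have -> : ((v ^+ 2) ^+ 3)^-1 = ((v ^+ 3 * pow32 R b) ^+ 2)^-1 * (b%:R ^+ 3)^-1.
  by rewrite [in RHS]exprMn sqr_pow32 //; field; rewrite !gt_eqF // ltr0n.
by apply: ler_wpM2r; rewrite // ge_min lexx orbT.
Qed.

(** For odd b, the odd and the even a carry equal main terms with densities 3/4 and 1/3: their mean
    is 13/24, and the two first-term errors add up to 13/12. For even b the density is always
    1/3. *)
Lemma sum_inv_large_density b N : (0 < b)%N ->
  \sum_(1 <= a < N.+1) density R (odd (a * b)) * inv_large b a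
    <= (if odd b then 13 / 24 else 1 / 3) * pow32 R b / v ^+ 3 + 13 / 12 * minb b.
Proof.
move=> b0; have m0 : 0 <= minb b by rewrite le_min !invr_ge0 !exprn_ge0 // ltW.
case: ifP => ob; last first.
  under eq_bigr do rewrite oddM ob andbF /=.
  rewrite -mulr_sumr; have := @sum_inv_large_residue 1 0 b N b0 isT.
  under eq_bigl do rewrite modn1 eqxx.
  rewrite divr1 /density => h.
  apply: le_trans (ler_wpM2l _ h) _ => //; rewrite mulrDr !mulrA lerD2l.
  by apply: ler_wpM2r => //; lra.
have split_res o : \sum_(1 <= a < N.+1 | odd a == o) density R (odd (a * b)) * inv_large b a
    <= density R o * (pow32 R b / v ^+ 3 / 2 + minb b).
  under eq_bigr => a /eqP ao do rewrite oddM ob andbT ao.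
  rewrite -mulr_sumr; apply: ler_wpM2l; first by rewrite /density; case: o; lra.
  have := @sum_inv_large_residue 2 o b N b0 isT; apply: le_trans.
  rewrite le_eqVlt; apply/orP; left; apply/eqP; apply: eq_bigl => a.
  by rewrite modn2; case: (odd a) o => [] [].
rewrite (bigID odd) /=.
have h1 := split_res true; have h2 := split_res false.
rewrite (eq_bigl odd) in h1; last by move=> a; rewrite eqb_id.
rewrite (eq_bigl (fun a => ~~ odd a)) in h2; last by move=> a; rewrite eqbF_neg.
apply: le_trans (lerD h1 h2) _; rewrite /density.
by rewrite le_eqVlt; apply/orP; left; apply/eqP; field; rewrite gt_eqF ?exprn_gt0.
Qed.

(** The main term is [sum_odd_even_sqfree]; the error constant is 13/12 times 3/2, that is 13/8 <=
    2. *)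
Lemma sum_inv_large_sqfree N :
  \sum_(1 <= b < N.+1 | sqfree b)
     \sum_(1 <= a < N.+1) density R (odd (a * b)) * inv_large b a
    <= lambda R / v ^+ 3 + 2 / v ^+ 4.
Proof.
have v3 : 0 < v ^+ 3 by rewrite exprn_gt0.
have b0 b : sqfree b -> (0 < b)%N by case/sqfreeP.
apply: (@le_trans _ _ (\sum_(1 <= b < N.+1 | sqfree b)
    ((if odd b then 13 / 24 else 1 / 3) * pow32 R b / v ^+ 3 + 13 / 12 * minb b))).
  by apply: ler_sum => b sb; apply: sum_inv_large_density; exact: b0.
rewrite big_split /= -mulr_suml; apply: lerD.
  apply: ler_wpM2r; first by rewrite invr_ge0 ltW.
  apply: le_trans (sum_odd_even_sqfree R N).
  rewrite (bigID odd) /= !mulr_sumr; apply: lerD.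
    by apply: ler_sum => b /andP[_ ->].
  by apply: ler_sum => b /andP[_ /negbTE ->].
have v2 : 0 < v ^+ 2 by rewrite exprn_gt0.
have m0 b : 0 <= minb b by rewrite le_min !invr_ge0 !exprn_ge0 // ltW.
rewrite -mulr_sumr; apply: (@le_trans _ _ (13 / 12 * (3 / 2 / (v ^+ 2) ^+ 2))).
  apply: ler_wpM2l; first by lra.
  apply: le_trans (sum_min_inv_cube N v2).
  rewrite [leRHS](bigID sqfree) /= lerDl; by apply: sumr_ge0 => b _; exact: m0.
rewrite -exprM mulrA; apply: ler_wpM2r; last by lra.
by rewrite invr_ge0 exprn_ge0 // ltW.
Qed.

End squarefull.

(** A union bound over (a, b): the number of admissible m is at most the density times x / (a^2
    b^3). *)
Lemma count_squarefull_part (R : realType) (x y Y v : R) :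
  8 < y -> 0 < Y -> 2 * Y ^+ 2 = y -> 1 < v -> 0 <= x ->
  ((\sum_(1 <= n < (Num.truncn x).+1 | [&& pnd n, (y < (max_pdiv n)%:R)%R
     & (v ^+ 6 < (n`_(primes_upto Y)`_(multiple_primes n))%N%:R)%R]) 1)%N)%:R
    <= lambda R * x / v ^+ 3 + 2 * x / v ^+ 4.
Proof.
move=> y8 Y0 YE v1 x0.
have v0 : 0 < v := lt_trans ltr01 v1.
set N := Num.truncn x.
have Nx : N%:R <= x by rewrite -truncn_ge_nat.
pose c a b := (a ^ 2 * b ^ 3)%N.
pose As b := [seq a <- index_iota 1 N.+1 | v ^+ 6 < (c a b)%:R].
pose Ms a b := [seq m <- index_iota 1 (N %/ c a b).+1 | cofactor_ok (odd (a * b)) m].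
pose Bs := [seq b <- index_iota 1 N.+1 | sqfree b].
have -> : lambda R * x / v ^+ 3 + 2 * x / v ^+ 4 = x * (lambda R / v ^+ 3 + 2 / v ^+ 4).
  by ring.
apply: le_trans (ler_wpM2l x0 (sum_inv_large_sqfree v0 N)).
apply: (@le_trans _ _ (\sum_(b <- Bs) \sum_(a <- As b) \sum_(m <- Ms a b) 1)%N%:R).
  rewrite ler_nat -big_filter.
  (* The triple sum is the length of the list of all products a^2 b^3 m, which contains every n
     counted. *)
  under [leqRHS]eq_bigr do rewrite -(big_allpairs_dep (h := fun a m : nat => (a, m)) (F := fun=> 1%N)).
  rewrite -(big_allpairs_dep (h := fun b (am : nat * nat) => (c am.1 b * am.2)%N) (F := fun=> 1%N)).
  apply: leq_sum_sub => [|n]; first by rewrite filter_uniq ?iota_uniq.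
  rewrite mem_filter mem_index_iota ltnS => /andP[/and3P[pn yp sv] /andP[n0 nN]].
  have [a [b [m [nE a0 sb cv [m8 om]]]]] := pnd_squarefull_part y8 Y0 YE pn yp sv.
  have [b0 _] := sqfreeP _ sb.
  have c0 : (0 < c a b)%N by rewrite muln_gt0 !expn_gt0 a0 b0.
  have m0 : (0 < m)%N by apply: leq_trans m8.
  have cN : (c a b <= N)%N by apply: leq_trans nN; rewrite nE leq_pmulr.
  apply/allpairsPdep; exists b, (a, m); split=> //.
    rewrite mem_filter sb mem_index_iota b0 ltnS; apply: leq_trans cN.
    by rewrite /c -{1}(expn1 b) (leq_trans _ (leq_pmull _ _)) ?expn_gt0 ?a0 // leq_pexp2l.
  apply/allpairsPdep; exists a, m; split=> //.
    rewrite mem_filter cv mem_index_iota a0 ltnS; apply: leq_trans cN.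
    by rewrite /c -{1}(expn1 a) (leq_trans _ (leq_pmulr _ _)) ?expn_gt0 ?b0 // leq_pexp2l.
  have mcE : (m * c a b = n)%N by rewrite nE mulnC.
  rewrite mem_filter mem_index_iota m0 ltnS leq_divRL // mcE nN.
  by rewrite /cofactor_ok m8 om.
rewrite natr_sum mulr_sumr /Bs big_filter.
rewrite [leRHS](eq_bigl (fun b => sqfree b)) //.
apply: ler_sum => b sb; have [b0 _] := sqfreeP _ sb.
rewrite natr_sum mulr_sumr /As big_filter big_mkcond /= big_nat [leRHS]big_nat.
apply: ler_sum => a /andP[a0 _]; rewrite -/(c a b).
case: ifP => _; last by rewrite !mulr0.
have c0 : (0 < c a b)%N by rewrite muln_gt0 !expn_gt0 a0 b0.
rewrite /Ms big_filter; apply: le_trans (count_cofactor R _ _) _.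
rewrite mulrCA; apply: ler_wpM2l; first by rewrite /density; case: odd; lra.
rewrite ler_pdivlMr ?ltr0n //; apply: le_trans Nx.
by rewrite -natrM ler_nat leq_divM.
Qed.

(** * The lower bound for the smooth part *)

Lemma le_primes_upto_part (R : realType) (x y Y b : R) (n : nat) :
  8 < y -> 0 < Y -> 2 * Y ^+ 2 = y ->
  y `^ (- b) = 2 - 2 * (1 + Y^-1) `^ (- 2 * ln x / ln (y / 2)) ->
  pnd n -> y < (max_pdiv n)%:R -> n%:R <= x ->
  y `^ b <= (n`_(primes_upto Y))%N%:R.
Proof.
move=> y8 Y0 YE hb pn yp nx; have n0 := pnd_gt0 pn.
have Y2 : 2 < Y by rewrite -(@ltr_pXn2r _ 2) ?nnegrE // ?ltW //; lra.
have Yy : Y < y by rewrite -YE expr2; nra.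
set d := (n`_(primes_upto Y))%N; set r := (n`_(primes_upto Y)^')%N.
have drE : (d * r)%N = n by exact: partnC.
have d0 : (0 < d)%N by exact: part_gt0.
have r0 : (0 < r)%N by exact: part_gt0.
have [q qp qr|k [sr Yr]] := sigma_rough Y0 r0.
  by have := dvd_part_in qp qr; rewrite !inE /= -ltNge.
have [pp pdn _] := pnd_large_prime y8 pn yp.
(* P(n) > Y does not divide d, so d is a proper divisor, hence deficient; by integrality sigma(d) <=
   2 d - 1. *)
have dn : (d < n)%N.
  rewrite ltn_neqAle dvdn_leq ?dvdn_part // andbT; apply/eqP => dE.
  move: pdn; rewrite -{2}dE => /(dvd_part_in pp); rewrite inE /= => /(lt_le_trans yp).
  by rewrite ltNge ltW.
have sd : (sigma d)%:R + 1 <= 2 * d%:R :> R.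
  rewrite natr1 -natrM ler_nat; apply: (pnd_dvd_sigma pn) => //.
  exact: dvdn_part.
have Y1 : 1 <= 1 + Y^-1 by rewrite lerDl invr_ge0 ltW.
have lnY : 0 < ln Y by rewrite ln_gt0 //; lra.
(* So the exponent in [hb] is -log x / log Y, and Y^k <= r <= x bounds k by log x / log Y. *)
have lny : ln (y / 2) = 2 * ln Y.
  have -> : y / 2 = Y * Y by rewrite -YE expr2; field.
  by rewrite lnM ?posrE //; ring.
have x0 : 0 < x by apply: lt_le_trans nx; rewrite ltr0n.
have rx : r%:R <= x.
  by apply: le_trans nx; rewrite ler_nat -drE leq_pmull.
set C := (1 + Y^-1) `^ (2 * ln x / ln (y / 2)).
have C0 : 0 < C by rewrite powR_gt0 //; lra.
have kC : (1 + Y^-1) ^+ k <= C.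
  rewrite -powR_mulrn ?(le_trans _ Y1) // ler_powR // lny.
  have -> : 2 * ln x / (2 * ln Y) = ln x / ln Y by field; rewrite gt_eqF.
  rewrite ler_pdivlMr // mulrC mulr_natr -lnXn //.
  by rewrite ler_ln ?posrE ?exprn_gt0 // (le_trans Yr).
have hbC : y `^ (- b) = 2 - 2 / C.
  by rewrite hb; congr (_ - _ * _); rewrite /C -powRN; congr (_ `^ _); ring.
have dC : 2 * d%:R <= (sigma d)%:R * C.
  have rR : 0 < r%:R :> R by rewrite ltr0n.
  rewrite -(ler_pM2r rR).
  apply: (@le_trans _ _ ((sigma d)%:R * (sigma r)%:R)).
    rewrite -mulrA -!natrM ler_nat drE; apply: leq_trans (pnd_sigma pn) _.
    by rewrite -{1}drE sigma_leM.
  by rewrite -mulrA ler_wpM2l // (le_trans sr) // mulrC ler_wpM2r.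
have {}dC : 2 * d%:R / C <= (sigma d)%:R by rewrite ler_pdivrMr.
have yb : 0 < y `^ b by rewrite powR_gt0 //; lra.
(* From 2 d / C <= sigma(d) <= 2 d - 1 and y^(-b) = 2 - 2/C. *)
have : 1 <= y `^ (- b) * d%:R.
  rewrite hbC mulrBl; have -> : 2 / C * d%:R = 2 * d%:R / C by rewrite mulrAC.
  by lra.
by rewrite powRN mulrC ler_pdivlMr // mul1r.
Qed.

(** * The two cases combined *)

Lemma M_split (R : realType) (x y Y v : R) :
  (M x y =
   \sum_(1 <= n < (Num.truncn x).+1 | [&& pnd n, (y < (max_pdiv n)%:R)%R
     & ((n`_(primes_upto Y)`_(multiple_primes n))%N%:R <= v ^+ 6)%R]) 1 +
   \sum_(1 <= n < (Num.truncn x).+1 | [&& pnd n, (y < (max_pdiv n)%:R)%R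
     & (v ^+ 6 < (n`_(primes_upto Y)`_(multiple_primes n))%N%:R)%R]) 1)%N.
Proof.
rewrite /M (bigID (fun n => (n`_(primes_upto Y)`_(multiple_primes n))%N%:R <= v ^+ 6)) /=.
by congr addn; apply: eq_bigl => n; rewrite -!andbA // -ltNge.
Qed.

Theorem theorem2p3 (R : realType) (x y b : R)
    (hy : 8 < y) (hxy : y < x)
    (hb : y `^ (- b) =
          2 - 2 * (1 + Num.sqrt (2 / y)) `^ (- 2 * ln x / ln (y / 2)))
    (hb0 : 0 < b) (hb2 : b < 1 / 2) :
  (M x y)%:R <=
    (lambda R + 1) * x * y `^ (- b / 3) + 2 * x * y `^ (- (4 * b) / 9).
Proof.
have y0 : 0 < y by lra.
have x0 : 0 <= x by lra.
pose Y := Num.sqrt (y / 2).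
have Y0 : 0 < Y by rewrite sqrtr_gt0; lra.
have YE : 2 * Y ^+ 2 = y by rewrite sqr_sqrtr; [field|lra].
have YV : Num.sqrt (2 / y) = Y^-1.
  by rewrite -sqrtrV; [congr Num.sqrt; field; rewrite gt_eqF|lra].
rewrite YV in hb.
pose v := y `^ (b / 9).
have v1 : 1 < v.
  have b9 : 0 < b / 9 by lra.
  by have := @gt0_ltr_powR R _ b9 1 y; rewrite powR1; apply; rewrite ?nnegrE; lra.
have vX k : v ^+ k = y `^ (b / 9 * k%:R) by rewrite -powR_mulrn ?powR_ge0 // -powRrM.
have vY : v ^+ 6 <= Y.
  (* u lies between v^6 and Y: v^6 = y^(2b/3) <= u because b < 1/2, and u^2 <= u^3 / 2 = Y^2 because
     y > 8 gives u > 2. *)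
  pose u := y `^ (1 / 3).
  have u3 : u ^+ 3 = y.
    rewrite -powR_mulrn ?powR_ge0 // -powRrM; have -> : 1 / 3 * 3 = 1 :> R by field.
    by rewrite powRr1 // ltW.
  have u0 : 0 <= u by exact: powR_ge0.
  apply: (@le_trans _ _ u).
    by rewrite vX ler_powR; lra.
  rewrite -(@ler_pXn2r _ 2) ?nnegrE ?(ltW Y0) //.
  have u2 : 2 < u by rewrite -(@ltr_pXn2r _ 3) ?nnegrE // u3; lra.
  have -> : Y ^+ 2 = u ^+ 2 * (u / 2) by rewrite -(mulrC (u / 2)) mulrAC -exprS u3 -YE; field.
  by rewrite ler_peMr ?exprn_ge0 //; lra.
have -> : y `^ (- b / 3) = (v ^+ 3)^-1 by rewrite vX -powRN; congr (_ `^ _); field.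
have -> : y `^ (- (4 * b) / 9) = (v ^+ 4)^-1 by rewrite vX -powRN; congr (_ `^ _); field.
rewrite (M_split x y Y v) natrD.
have smooth n : pnd n -> y < (max_pdiv n)%:R -> n%:R <= x ->
    v ^+ 9 <= (n`_(primes_upto Y))%N%:R.
  move=> pn yp nx; rewrite vX; have -> : b / 9 * 9 = b by field.
  exact: le_primes_upto_part hb pn yp nx.
have h1 := count_sqfree_part hy Y0 YE v1 vY x0 smooth.
have h2 := count_squarefull_part hy Y0 YE v1 x0.
apply: le_trans (lerD h1 h2) _.
by rewrite le_eqVlt; apply/orP; left; apply/eqP; ring.
Qed.
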